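(* If $m\geq 3$ is an integer, then $\alpha(C(P_{m}))=\left\lfloor \frac{(m+1)^{2}}{4}\right\rfloor$.
   Context: Graphs are finite and simple. For a graph $G$, the pair graph $C(G)$ (also called complete double vertex graph) is the graph whose vertices are all $2$-multisets of $V(G)$ (so $\{x,x\}$ is allowed), where two vertices $\{x,y\}$ and $\{u,v\}$ are adjacent if and only if $\{x,y\}\cap\{u,v\}=\{a\}$ (multiset intersection) for some $a$ and, writing $x=u=a$, the vertices $y$ and $v$ are adjacent in $G$; that is, the two multisets can be written as $\{a,y\}$ and $\{a,v\}$ with $yv$ an edge of $G$. $P_m$ is the path graph with $m$ vertices, and $\alpha(G)$ denotes the independence number of $G$. *)

(* Defs.v *)
From HB Require Import structures.
From mathcomp Require Import all_boot.
From mathcomp Require Import finmap multiset.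

Set Implicit Arguments.
Unset Strict Implicit.
Unset Printing Implicit Defensive.

Local Open Scope mset_scope.

Record sgraph := SGraph {
  vertex :> finType;
  edge : rel vertex;
  edge_sym : symmetric edge;
  edge_irrefl : irreflexive edge
}.
Arguments edge {s}.

Definition independent (G : sgraph) (S : {set G}) : bool :=
  [forall x in S, forall y in S, ~~ edge x y].

Definition alpha (G : sgraph) : nat :=
  \max_(S : {set G} | independent S) #|S|.

(* [size] counts elements with multiplicity, so {x, x} is included. *)
Record mset2 (T : choiceType) := Mset2 {
  mset2_val :> {mset T};
  mset2P : size mset2_val == 2
}.

HB.instance Definition _ (T : choiceType) := [isSub for @mset2_val T].
HB.instance Definition _ (T : choiceType) := [Choice of mset2 T by <:].

Section Mset2Finite.
Variable T : finType.

Definition mset2_mult (A : mset2 T) : {ffun T -> 'I_3} :=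
  [ffun x => inord (mset2_val A x)].

Definition mset2_unmult (f : {ffun T -> 'I_3}) : option (mset2 T) :=
  insub (seq_mset (flatten [seq nseq (f x) x | x <- enum T])).

Lemma mset2_multK : pcancel mset2_mult mset2_unmult.
Proof.
move=> A; rewrite /mset2_unmult.
suff -> : seq_mset (flatten [seq nseq (mset2_mult A x) x | x <- enum T])
          = val A by rewrite valK.
apply/msetP => x; rewrite mset_seqE count_flatten -map_comp sumn_map.
rewrite big_enum /= (bigD1 x) //= big1 ?addn0.
  rewrite count_nseq /= eqxx mul1n ffunE inordK //.
  by rewrite -count_mem_mset (leq_ltn_trans (count_size _ _)) // (eqP (mset2P A)).
by move=> y /negPf neq_yx; rewrite count_nseq /= neq_yx.
Qed.

HB.instance Definition _ : isCountable (mset2 T) :=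
  PCanIsCountable mset2_multK.
HB.instance Definition _ : isFinite (mset2 T) := PCanIsFinite mset2_multK.

End Mset2Finite.

Section PairGraph.
Variable G : sgraph.

Definition pair_edge (A B : mset2 G) : bool :=
  [exists a : G, exists y : G, exists v : G,
    [&& mset2_val A == [mset a; y], mset2_val B == [mset a; v],
        mset2_val A `&` mset2_val B == [mset a] & edge y v]].

Lemma pair_edge_sym : symmetric pair_edge.
Proof.
suff imp A B : pair_edge A B -> pair_edge B A.
  by move=> A B; apply/idP/idP; apply: imp.
case/existsP=> a /existsP[y /existsP[v /and4P[eA eB eAB eyv]]].
apply/existsP; exists a; apply/existsP; exists v; apply/existsP; exists y.
by rewrite eA eB msetIC eAB edge_sym.
Qed.

Lemma pair_edge_irrefl : irreflexive pair_edge.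
Proof.
move=> A; apply/existsP=> -[a /existsP[y /existsP[v /and4P[/eqP eA _]]]].
rewrite msetIid eA => /eqP /msetP /(_ y).
by rewrite mset1DE !msetnE eqxx; case: (y == a).
Qed.

Definition pair_graph : sgraph := SGraph pair_edge_sym pair_edge_irrefl.

End PairGraph.

Section PathGraph.
Variable m : nat.

Definition path_edge (i j : 'I_m) : bool :=
  (i.+1 == j :> nat) || (j.+1 == i :> nat).

Lemma path_edge_sym : symmetric path_edge.
Proof. by move=> i j; rewrite /path_edge orbC. Qed.

Lemma path_edge_irrefl : irreflexive path_edge.
Proof.
by move=> i; rewrite /path_edge orbb; apply/negbTE; rewrite neq_ltn ltnSn orbT. Qed.

Definition path_graph : sgraph := SGraph path_edge_sym path_edge_irrefl.

End PathGraph.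

(* Main.v *)
Require Import Defs.
From mathcomp Require Import all_boot.
From mathcomp Require Import finmap multiset zify.

(** Writing a 2-multiset of vertices of [P_m] as a pair [i <= j], the pair graph
    is a triangular piece of the square grid, properly 2-coloured by the parity
    of [i + j].  The even class is independent.  Conversely
    [(i, j) |-> (i, j - 1)] matches the odd class into the even one, so the
    vertices are covered by as many edges and single vertices as there are even
    vertices, and an independent set meets each of these at most once. *)

Local Open Scope mset_scope.

(** Sequences make sizes and permutation lemmas available for 2-multisets. *)
Lemma mset_pairE (T : choiceType) (x y : T) : [mset x; y] = seq_mset [:: x; y].
Proof.
by apply/msetP => z; rewrite mset1DE !msetnE mset_seqE /= addn0 !(eq_sym z);
  case: (y == z).
Qed.

Lemma mset_pair_inj (T : choiceType) (x y u v : T) :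
  [mset x; y] = [mset u; v] -> (x = u /\ y = v) \/ (x = v /\ y = u).
Proof.
have perm1 (a b c : T) : perm_eq [:: a; b] [:: a; c] -> b = c.
  by rewrite perm_cons => /perm_mem/(_ b); rewrite !inE eqxx => /esym/eqP.
rewrite !mset_pairE => /eq_seq_msetP e.
have := perm_mem e x; rewrite !inE eqxx /= => /esym/orP[]/eqP ex; subst x.
  by left; split=> //; apply: perm1 e.
right; split=> //; apply: (perm1 v).
by rewrite (perm_trans e) // (perm_catC [:: u] [:: v]).
Qed.

Lemma size_mset_pair (T : choiceType) (x y : T) : size [mset x; y] == 2.
Proof. by rewrite mset_pairE (perm_size (perm_eq_seq_mset _)). Qed.

Definition pair_mset2 (T : choiceType) (p : T * T) : mset2 T :=
  Mset2 (size_mset_pair T p.1 p.2).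

Lemma mset2_pair (T : choiceType) (A : mset2 T) :
  exists x y, mset2_val A = [mset x; y].
Proof.
rewrite -[mset2_val A]seq_mset_id.
case: (EnumMset.f _) (valP A) => [|x [|y [|z s]]] //= _.
by exists x, y; rewrite mset_pairE.
Qed.

Lemma sum_same_parity (n j : nat) :
  \sum_(i < n) (~~ odd (i + j) : nat) = (n + ~~ odd j)./2.
Proof.
elim: n => [|n IHn]; first by rewrite big_ord0; case: (odd j).
by rewrite big_ord_recr /= IHn; lia.
Qed.

Lemma sum_half_succ (n : nat) : \sum_(j < n) j./2.+1 = (n + 1) ^ 2 %/ 4.
Proof.
elim: n => [|n IHn]; first by rewrite big_ord0.
rewrite big_ord_recr /= IHn.
(* Writing [n] as [b + 2h] turns both floors into polynomials in [h], one case for each parity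
   [b]. *)
have := odd_double_half n; move: (odd n) (n./2) => b h <-.
by case: b; rewrite -!mul2n !expnS; nia.
Qed.

Section PathPairs.
Variable m : nat.
Let G := path_graph m.

Definition even_pairs : {set 'I_m * 'I_m} :=
  [set p : 'I_m * 'I_m | (p.1 <= p.2) && ~~ odd (p.1 + p.2)].

(** The count goes by the larger entry [j]: the [i <= j] with the parity of [j] number [j./2.+1]. *)
Lemma card_even_pairs : #|even_pairs| = (m + 1) ^ 2 %/ 4.
Proof.
rewrite -sum_half_succ -sum1_card big_mkcond /=.
rewrite (eq_bigr (fun p => if (p.1, p.2) \in even_pairs then 1 else 0)); last by case.
rewrite -(pair_bigA _ (fun i j => if (i, j) \in even_pairs then 1 else 0)) /=.
rewrite exchange_big /=; apply: eq_bigr => j _.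
transitivity (\sum_(i < j.+1) (~~ odd (i + j) : nat)).
  rewrite (big_ord_widen m (fun i => ~~ odd (i + j) : nat) (ltn_ord j)).
  rewrite [RHS]big_mkcond; apply: eq_bigr => i _; rewrite inE /= ltnS.
  by case: leqP => //= _; case: odd.
by rewrite sum_same_parity; lia.
Qed.

Lemma pair_mset2_inj (p q : 'I_m * 'I_m) :
  p.1 <= p.2 -> q.1 <= q.2 ->
  pair_mset2 'I_m p = pair_mset2 'I_m q -> p = q.
Proof.
case: p q => [i j] [k l] /= leij lekl.
move=> /(congr1 (@mset2_val _)) /= /mset_pair_inj [[-> ->] //|[ei ej]].
by subst; congr (_, _); apply: val_inj => /=; lia.
Qed.

Lemma pair_mset2_onto (A : pair_graph G) :
  exists2 p : 'I_m * 'I_m, p.1 <= p.2 & A = pair_mset2 'I_m p.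
Proof.
have [x [y eA]] := mset2_pair _ A.
have [lexy|/ltnW leyx] := leqP (x : 'I_m) (y : 'I_m).
  by exists (x, y) => //; apply: val_inj.
by exists (y, x) => //; apply: val_inj; rewrite /= eA msetDC.
Qed.

(** An edge keeps one entry [a] and moves the other one step along the path, so the sum of the
    entries changes by exactly one. *)
Lemma pair_edge_parity (p q : 'I_m * 'I_m) :
  @pair_edge G (pair_mset2 G p) (pair_mset2 G q) ->
  odd (p.1 + p.2) != odd (q.1 + q.2).
Proof.
case: p q => [i j] [k l] /existsP[a /existsP[y /existsP[v]]].
move=> /and4P[/eqP/mset_pair_inj /= e1 /eqP/mset_pair_inj /= e2 _].
have -> : i + j = (a : 'I_m) + (y : 'I_m) by case: e1 => -[-> ->] //; apply: addnC.
have -> : k + l = (a : 'I_m) + (v : 'I_m) by case: e2 => -[-> ->] //; apply: addnC.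
by rewrite /edge /= /path_edge; lia.
Qed.

Lemma pair_edge_step (i j k : 'I_m) : k.+1 = j ->
  @pair_edge G (pair_mset2 G (i, j)) (pair_mset2 G (i, k)).
Proof.
move=> ejk; apply/existsP; exists i; apply/existsP; exists j; apply/existsP; exists k.
rewrite /= !eqxx /= /edge /= /path_edge ejk eqxx orbT andbT.
apply/eqP/msetP => z; rewrite !msetE2 !msetnE.
(* The common [i] contributes equally to both multiplicities, so their minimum exceeds [z == i] only
   if [z] is both [j] and [k]. This also covers [i = j] and [i = k]. *)
have : ~~ ((z == j) && (z == k)).
  by apply/negP => /andP[/eqP -> /eqP ej]; move: ejk; rewrite ej; lia.
by case: (z == i); case: (z == j); case: (z == k).
Qed.

Lemma ord_pred_subproof (j : 'I_m) (b : bool) : j - b < m.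
Proof. exact: leq_ltn_trans (leq_subr _ _) (ltn_ord j). Qed.

(** The matching, extended by the identity on even pairs, so that its fibres are the covering edges
    and single vertices. Truncated subtraction makes it total. *)
Definition to_even (p : 'I_m * 'I_m) : 'I_m * 'I_m :=
  (p.1, Ordinal (ord_pred_subproof p.2 (odd (p.1 + p.2)))).

(** An odd sum excludes [i = j], so [i <= j - 1] and the pair stays sorted. *)
Lemma to_even_in (p : 'I_m * 'I_m) : p.1 <= p.2 -> to_even p \in even_pairs.
Proof. by case: p => i j /= leij; rewrite inE /=; lia. Qed.

Lemma to_even_eq (p q : 'I_m * 'I_m) : p.1 <= p.2 -> q.1 <= q.2 ->
  to_even p = to_even q ->
  [\/ p = q, @pair_edge G (pair_mset2 G p) (pair_mset2 G q)
    | @pair_edge G (pair_mset2 G q) (pair_mset2 G p)].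
Proof.
case: p q => [i j] [k l] /= leij lekl [<-{k lekl} e].
have [ejl|/eqP nejl] := eqVneq (j : nat) l.
  by constructor 1; congr (_, _); apply: val_inj.
have [ej|el] : l.+1 = j \/ j.+1 = l by lia.
  by constructor 2; apply: pair_edge_step.
by constructor 3; apply: pair_edge_step.
Qed.

Lemma independent_even :
  @independent (pair_graph G) [set pair_mset2 G p | p in even_pairs].
Proof.
apply/forall_inP => _ /imsetP[p + ->]; rewrite inE => /andP[_ evp].
apply/forall_inP => _ /imsetP[q + ->]; rewrite inE => /andP[_ evq].
by apply/negP => /pair_edge_parity; rewrite (negPf evp) (negPf evq).
Qed.

Lemma card_independent (S : {set pair_graph G}) :
  independent S -> #|S| <= #|even_pairs|.
Proof.
move=> /forall_inP indS.
have noedge A B : A \in S -> B \in S -> ~~ @pair_edge G A B.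
  by move=> AS BS; apply: (forall_inP (indS A AS)).
pose P := [set p : 'I_m * 'I_m | (p.1 <= p.2) && (pair_mset2 G p \in S)].
have subS : S \subset [set pair_mset2 G p | p in P].
  apply/subsetP => A AS; have [p lep eA] := pair_mset2_onto A.
  by apply/imsetP; exists p => //; rewrite inE lep /= -[X in X \in S]eA.
apply: leq_trans (subset_leq_card subS) _.
apply: leq_trans (leq_imset_card _ _) _.
(* A collision of [to_even] on [P] would be an edge inside [S], so [to_even] is injective there. *)
rewrite -(card_in_imset (f := to_even) (D := mem P)); last first.
  move=> p q; rewrite !inE => /andP[lep pS] /andP[leq qS] /to_even_eq.
  by case=> // e; [have := noedge _ _ pS qS | have := noedge _ _ qS pS]; rewrite e.
apply: subset_leq_card; apply/subsetP => _ /imsetP[p + ->].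
by rewrite inE => /andP[lep _]; apply: to_even_in.
Qed.

End PathPairs.

Theorem theorem1p3 (m : nat) (hm : 3 <= m) :
  alpha (pair_graph (path_graph m)) = (m + 1) ^ 2 %/ 4.
Proof.
rewrite -card_even_pairs; apply/eqP; rewrite eqn_leq; apply/andP; split.
  by apply/bigmax_leqP => S; apply: card_independent.
(* For the lower bound, the even class has as many vertices as [even_pairs], since sorted pairs
   represent multisets uniquely. *)
have <- : #|[set pair_mset2 (path_graph m) p | p in even_pairs m]| = #|even_pairs m|.
  apply: card_in_imset => p q; rewrite !inE => /andP[lep _] /andP[leq _].
  exact: pair_mset2_inj.
exact: (leq_bigmax_cond (F := fun S : {set pair_graph (path_graph m)} => #|S|)
  _ (independent_even m)).
Qed.
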